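(* Let $d\ge 1$ be an integer, let $1/2<\alpha<1$ and $p_n=n^{-\alpha}$. Then the Linial–Meshulam complex $Y_d(n,p_n)$ cannot be reconstructed from its $1$-neighbourhoods with high probability; that is, with high probability there exists a complex $\widetilde X$ of the form described in the context such that $N_{1,\widetilde X}(\sigma)\simeq N_{1,Y_d(n,p_n)}(\sigma)$ for all $\sigma\in X_{d-1}$ but $\widetilde X\not\simeq Y_d(n,p_n)$.
   Context: Let $X_0=\{1,\dots,n\}$ and, for $k\ge 0$, let $X_k$ be the set of all $(k+1)$-element subsets of $X_0$; $X_{-1}=\{\emptyset\}$. A complex ''of the form'' considered is $X=\left(\bigcup_{k=-1}^{d-1}X_k\right)\cup X^d$ with $X^d\subseteq X_d$. The Linial–Meshulam model $Y_d(n,p)$ is the random such complex in which each element of $X_d$ is put in $X^d$ independently with probability $p$. For $\sigma,\sigma'\in X_{d-1}$ write $\sigma\sim\sigma'$ if $\sigma\cup\sigma'\in X^d$; let $S_\sigma=\{\sigma'\in X_{d-1}:\sigma'\sim\sigma\}$ and $X_{\sigma,1}=\{\sigma\}\cup S_\sigma$. The $1$-neighbourhood of $\sigma\in X_{d-1}$ is $N_{1,X}(\sigma)=\{\tau\in X:\tau\subseteq\sigma'\cup\sigma''\text{ for some }\sigma',\sigma''\in X_{\sigma,1}\}$. Two set systems closed under subsets, $A$ on vertex set $V$ and $B$ on vertex set $W$, are isomorphic ($A\simeq B$) if there is a bijection $f:V\to W$ with $\tau\in A\iff f(\tau)\in B$. A sequence of events $A_n$ occurs with high probability if $P(A_n^c)=o(n^{-s})$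 for some $s>0$. *)

(* Defs.v *)
From mathcomp Require Import all_boot all_order all_algebra.
From mathcomp Require Import all_classical all_reals all_analysis.
Set Implicit Arguments.
Unset Strict Implicit.
Unset Printing Implicit Defensive.
Import Order.TTheory GRing.Theory Num.Theory.
Import numFieldNormedType.Exports.
Local Open Scope ring_scope.

(* The vertex set {1,...,n} is represented by 'I_n, and a complex by the set
   system of all its simplices, the empty simplex included. *)
Section Complexes.
Variable n : nat.
Implicit Types (sigma tau : {set 'I_n}) (F X : {set {set 'I_n}}).

(* X_k, for k >= 0 *)
Definition faces (k : nat) : {set {set 'I_n}} :=
  [set tau : {set 'I_n} | #|tau| == k.+1].

(* X_{-1} \cup X_0 \cup ... \cup X_{d-1} *)
Definition full_skeleton (d : nat) : {set {set 'I_n}} :=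
  [set tau : {set 'I_n} | (#|tau| <= d)%N].

Definition complex_of (d : nat) F : {set {set 'I_n}} := full_skeleton d :|: F.

Definition full_skeleton_complex (d : nat) X : Prop :=
  exists2 F : {set {set 'I_n}}, F \subset faces d & X = complex_of d F.

(* The intersection with X_d matters: without it every sigma would be adjacent
   to itself. *)
Definition adjacent (d : nat) X sigma sigma' : bool :=
  sigma :|: sigma' \in X :&: faces d.

(* X_{sigma,1}, for d >= 1 *)
Definition ball1 (d : nat) X sigma : {set {set 'I_n}} :=
  sigma |: [set sigma' : {set 'I_n} in faces d.-1 | adjacent d X sigma' sigma].

Definition nbhd1 (d : nat) X sigma : {set {set 'I_n}} :=
  [set tau in X | [exists sigma' in ball1 d X sigma,
                   exists sigma'' in ball1 d X sigma,
                     tau \subset sigma' :|: sigma'']].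

(* Probability that Y_d(n,p) satisfies E: its set of d-simplices is equal to F
   with probability p^|F| (1-p)^(|X_d| - |F|). *)
Definition LM_prob (R : realType) (d : nat) (p : R)
    (E : {set {set 'I_n}} -> Prop) : R :=
  \sum_(F in powerset (faces d) | `[< E (complex_of d F) >])
    \prod_(tau in faces d) (if tau \in F then p else 1 - p).

End Complexes.

(* A is a set system on the vertex set V, B one on the vertex set W. *)
Definition isomorphic (T U : finType) (V : {set T}) (A : {set {set T}})
    (W : {set U}) (B : {set {set U}}) : Prop :=
  exists f : T -> U,
    [/\ {in V &, injective f}, f @: V = W
      & forall tau : {set T}, tau \subset V -> (tau \in A) = (f @: tau \in B)].

(* 1-neighbourhoods are complexes on the union of their simplices, whereas
   the complexes of the model have vertex set 'I_n. *)
Definition nbhd1_isomorphic (n d : nat) (X X' : {set {set 'I_n}})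
    (sigma : {set 'I_n}) : Prop :=
  isomorphic (finset.cover (nbhd1 d X sigma)) (nbhd1 d X sigma)
             (finset.cover (nbhd1 d X' sigma)) (nbhd1 d X' sigma).

Definition complex_isomorphic (n : nat) (X X' : {set {set 'I_n}}) : Prop :=
  isomorphic [set: 'I_n]%SET X [set: 'I_n]%SET X'.

Local Open Scope classical_set_scope.

Definition with_high_probability (R : realType) (Omega : nat -> Type)
    (P : forall n, (Omega n -> Prop) -> R) (A : forall n, Omega n -> Prop) : Prop :=
  exists2 s : R, 0 < s &
    (fun n => P n (fun w => ~ A n w)) =o_\oo (fun n => n%:R `^ (- s)).

(* Main.v *)
Require Import Defs.
From mathcomp Require Import all_boot all_order all_algebra.
From mathcomp Require Import all_classical all_reals all_analysis.
From mathcomp Require Import zify ring lra fintype finset.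
Set Implicit Arguments.
Unset Strict Implicit.
Unset Printing Implicit Defensive.
Import Order.TTheory GRing.Theory Num.Theory.
Import numFieldNormedType.Exports.

(* The proof is a counting argument.  Up to isomorphism, the 1-neighbourhood of
   a (d-1)-simplex [sigma] is determined by the degree of [sigma] and by the
   d-simplices [sigma - a + v + w] with [v], [w] in the link of [sigma], where
   [v], [w] matter only through their ranks in the link.  By Markov's inequality
   there are at most [t = n^(d+2-3*alpha+eps)] such configurations with high
   probability, so that the neighbourhoods take at most
   [n^(O(n^d + t))] values.  The complexes that are determined by a given value
   are isomorphic, hence at most [n^n] in number, and each complex has
   probability at most [(1-p)^C(n,d+1) <= exp(- c n^(d+1-alpha))].  For
   [1/2 < alpha < 1] and [eps < 2*alpha-1], both [d] and [d+2-3*alpha+eps] are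
   smaller than [d+1-alpha], and the reconstructible complexes with few
   configurations have negligible total probability. *)

(** * Elementary counting bounds *)

Local Open Scope nat_scope.

(** A set of at most [t] elements is the set of values of a map from ['I_t] to [option T], with
    [None] as padding. *)
Lemma card_few_subsets (T : finType) (t : nat) :
  #|[set A : {set T} | #|A| <= t]| <= #|T|.+1 ^ t.
Proof.
rewrite -card_option -[X in _ ^ X]card_ord -card_ffun.
pose g (h : {ffun 'I_t -> option T}) := [set x | Some x \in codom h].
apply: leq_trans (leq_imset_card g _); apply: subset_leq_card.
apply/subsetP => A; rewrite inE => At; apply/imsetP.
exists [ffun i : 'I_t => onth (enum A) i] => //.
apply/setP => x; rewrite inE; apply/idP/codomP => [xA|[i]].
  have it : index x (enum A) < t.
    by apply: leq_trans At; rewrite cardE index_mem mem_enum.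
  exists (Ordinal it); rewrite ffunE /= onthE (nth_map x) ?nth_index ?mem_enum //.
  by rewrite index_mem mem_enum.
by rewrite ffunE => e; rewrite -mem_enum; apply/onthP; exists i.
Qed.

Lemma bin_leq_exp (n k : nat) : 'C(n, k) <= n ^ k.
Proof.
rewrite -[X in X <= _]muln1 (leq_trans (leq_mul (leqnn _) (fact_gt0 k))) //.
rewrite bin_ffact ffact_prod -[X in _ ^ X]card_ord -prod_nat_const.
by apply: leq_prod => i _; apply: leq_subr.
Qed.

(** * Description of 1-neighbourhoods through links *)

Section Neighbourhoods.
Variables n k : nat.
Implicit Types (F : {set {set 'I_n}}) (sigma tau : {set 'I_n}).

Definition link F sigma : {set 'I_n} := [set v | v |: sigma \in F].

Lemma in_complex_of d F tau :
  (tau \in complex_of d F) = (#|tau| <= d) || (tau \in F).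
Proof. by rewrite !inE. Qed.

Lemma complex_of_faces d F : F \subset faces n d ->
  complex_of d F :&: faces n d = F.
Proof.
move=> sF; apply/setP => tau; rewrite !inE.
have [tF|] := boolP (tau \in F); last by case: eqP => [->|]; rewrite ?ltnn ?andbF.
by move/subsetP: sF => /(_ _ tF); rewrite inE orbT => ->.
Qed.

(** If [v] were in [sigma], then [v |: sigma] would be [sigma], which is too small to lie in [F]. *)
Lemma link_notin F sigma v : F \subset faces n k.+1 -> #|sigma| = k.+1 ->
  v \in link F sigma -> v \notin sigma.
Proof.
move=> /subsetP sF cs; rewrite inE => /sF; rewrite inE cardsU1 cs.
by case: (v \in sigma); rewrite //= add0n eqn_leq ltnn andbF.
Qed.

Lemma ball1P F sigma tau : F \subset faces n k.+1 -> #|sigma| = k.+1 ->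
  reflect (tau = sigma \/ (#|tau| = k.+1 /\
     exists2 v, v \in link F sigma & tau :|: sigma = v |: sigma))
    (tau \in ball1 k.+1 (complex_of k.+1 F) sigma).
Proof.
move=> sF cs; rewrite /ball1 in_setU1 in_set /Defs.adjacent.
rewrite complex_of_faces // in_set /=.
apply: (iffP orP) => [[/eqP|/andP[/eqP ct tF]]|[->|[-> [v vL e]]]].
- by left.
- right; split=> //.
  have: #|tau :\: sigma| == 1.
    move/subsetP: sF => /(_ _ tF); rewrite inE.
    have := cardsUI tau sigma; have := cardsID sigma tau; lia.
  case/cards1P => v tv.
  have e : tau :|: sigma = v |: sigma.
    by apply/setP => x; move/setP/(_ x): tv; rewrite !inE; case: (x \in sigma); rewrite ?orbT ?orbF.
  by exists v => //; rewrite inE -e.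
- by left.
- by right; rewrite e eqxx; rewrite inE in vL.
Qed.

(** Each member of the ball adds at most one vertex to [sigma], taken from the link, so two members
    add at most two. Conversely, [sigma - a + v] and [sigma - a + w] cover [tau] if some [a] in
    [sigma] is outside [tau]; otherwise [sigma] and some [sigma - a + v] do, or [sigma] alone. *)
Lemma in_nbhd1 F sigma tau : F \subset faces n k.+1 -> #|sigma| = k.+1 ->
  (tau \in nbhd1 k.+1 (complex_of k.+1 F) sigma) =
  [&& tau \in complex_of k.+1 F, tau \subset sigma :|: link F sigma
    & #|tau :\: sigma| <= 2].
Proof.
move=> sF cs; rewrite inE; case: (boolP (tau \in complex_of _ _)) => //= tX.
apply/exists_inP/andP => [[s1 s1B /exists_inP[s2 s2B ts]]|[ts ct]].
  have H s : s \in ball1 k.+1 (complex_of k.+1 F) sigma ->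
     s \subset sigma :|: link F sigma /\ #|s :\: sigma| <= 1.
    case/(ball1P s sF cs) => [->|[_ [v vL e]]].
      by rewrite subsetUl setDv cards0.
    have sv : s \subset v |: sigma by rewrite -e subsetUl.
    split.
      by apply: subset_trans sv _; rewrite subUset sub1set inE vL orbT subsetUl.
    rewrite -(cards1 v); apply: subset_leq_card; apply/subsetP => x.
    by rewrite !inE => /andP[/negPf xs /(subsetP sv)]; rewrite !inE xs orbF.
  have [s1L c1] := H _ s1B; have [s2L c2] := H _ s2B.
  split; first by apply: subset_trans ts _; rewrite subUset s1L.
  apply: leq_trans (subset_leq_card (setSD sigma ts)) _.
  by rewrite setDUl; have := cardsUI (s1 :\: sigma) (s2 :\: sigma); lia.
have ball_sigma : sigma \in ball1 k.+1 (complex_of k.+1 F) sigma.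
  by apply/ball1P => //; left.
have ball_swap a v : a \in sigma -> v \in link F sigma ->
    v |: (sigma :\ a) \in ball1 k.+1 (complex_of k.+1 F) sigma.
  move=> aS vL; apply/ball1P => //; right; split.
    rewrite cardsU1 !inE negb_and (link_notin sF cs vL) orbT /=.
    by move: (cardsD1 a sigma); rewrite aS cs => -[->].
  by exists v => //; rewrite -setUA; congr (_ |: _); apply/setUidPr/subD1set.
have [sts|] := boolP (tau \subset sigma).
  exists sigma => //; apply/exists_inP; exists sigma => //.
  by rewrite setUid.
move=> /subsetPn[v vt vS].
have inL x : x \in tau -> x \notin sigma -> x \in link F sigma.
  by move=> xt xS; move/subsetP: ts => /(_ _ xt); rewrite inE (negPf xS).
have vL := inL v vt vS.
(* The choice [w = v] serves the case of a single vertex outside [sigma]. *)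
have [w [wL tvw]] : exists w, w \in link F sigma /\ tau :\: sigma \subset [set v; w].
  have [|] := boolP (tau :\: sigma \subset [set v]).
    by exists v; split=> //; rewrite setUid.
  case/subsetPn => w; rewrite !inE => /andP[wS wt] wv.
  exists w; split; first exact: inL.
  apply/subsetP => x xt.
  apply: contraLR ct => xvw; rewrite -ltnNge.
  have -> : 3 = #|x |: [set v; w]| by rewrite cardsU1 xvw cards2 eq_sym wv.
  apply: subset_leq_card; rewrite !subUset !sub1set xt !inE vt wt vS wS //.
(* Here [tau] is [sigma] plus [v], since a simplex has at most [k.+2] vertices; any [a] in [sigma]
   will do. *)
have [sst|] := boolP (sigma \subset tau).
  have e : tau :\: sigma = [set v].
    apply/esym/eqP; rewrite eqEcard sub1set !inE vt vS cards1 /=.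
    rewrite cardsDS //; move: tX; rewrite in_complex_of cs.
    case/orP => [|/(subsetP sF)]; rewrite ?inE; lia.
  have [a aS] : exists a, a \in sigma by apply/card_gt0P; rewrite cs.
  exists sigma => //; apply/exists_inP; exists (v |: (sigma :\ a)); first exact: ball_swap.
  apply/subsetP => x xt; move/setP: e => /(_ x); rewrite !inE xt andbT.
  by case: (x \in sigma) => //= <-.
case/subsetPn => a aS at'.
exists (v |: (sigma :\ a)); first exact: ball_swap.
apply/exists_inP; exists (w |: (sigma :\ a)); first exact: ball_swap.
apply/subsetP => x xt; move/subsetP: tvw => /(_ x); rewrite !inE xt andbT.
have -> : x != a by apply: contraNneq at' => <-.
by case: (x \in sigma) => /=; rewrite ?orbT // => /(_ isT) /orP[] ->; rewrite ?orbT.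
Qed.

Lemma cover_nbhd1 F sigma : F \subset faces n k.+1 -> #|sigma| = k.+1 ->
  finset.cover (nbhd1 k.+1 (complex_of k.+1 F) sigma) = sigma :|: link F sigma.
Proof.
move=> sF cs; apply/eqP; rewrite eqEsubset; apply/andP; split.
  by apply/bigcupsP => tau; rewrite in_nbhd1 // => /and3P[].
apply/subsetP => x xL; apply/bigcupP; exists [set x]; last by rewrite inE.
rewrite in_nbhd1 // in_complex_of cards1 sub1set xL /=.
by rewrite (leq_trans (subset_leq_card (subsetDl _ _))) // cards1.
Qed.

(** Sets of at most [k.+1] vertices belong to both complexes. A top simplex of the neighbourhood is
    either [v |: sigma], governed by the link, or [sigma] with one vertex [a] replaced by two link
    vertices, governed by the last hypothesis. *)
Lemma nbhd1_isomorphic_of_bij F1 F2 sigma (f : 'I_n -> 'I_n) :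
  F1 \subset faces n k.+1 -> F2 \subset faces n k.+1 -> #|sigma| = k.+1 ->
  {in sigma, forall x, f x = x} ->
  {in link F1 sigma &, injective f} ->
  f @: link F1 sigma = link F2 sigma ->
  (forall (pi : {set 'I_n}) a v w, sigma = a |: pi -> a \notin pi ->
     v \in link F1 sigma -> w \in link F1 sigma -> v != w ->
     (v |: (w |: pi) \in F1) = (f v |: (f w |: pi) \in F2)) ->
  nbhd1_isomorphic k.+1 (complex_of k.+1 F1) (complex_of k.+1 F2) sigma.
Proof.
move=> sF1 sF2 cs fs finj fL fF.
have fsigma : f @: sigma = sigma by rewrite -[RHS]imset_id; apply: eq_in_imset.
have fL2 x : x \in link F1 sigma -> f x \in link F2 sigma.
  by move=> xL; rewrite -fL imset_f.
have finS x : x \in sigma :|: link F1 sigma -> (f x \in sigma) = (x \in sigma).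
  rewrite inE; case/orP => xs; first by rewrite fs.
  by rewrite (negPf (link_notin sF2 cs (fL2 _ xs))) (negPf (link_notin sF1 cs xs)).
have injf : {in sigma :|: link F1 sigma &, injective f}.
  move=> x y xs ys e.
  have := finS x xs; rewrite e finS //; move: xs ys; rewrite !in_setU.
  case: (boolP (x \in sigma)) => /= xs; case: (boolP (y \in sigma)) => //= ys.
    by move: e; rewrite !fs.
  by move=> xL yL _; apply: finj.
exists f; rewrite !cover_nbhd1 //; split=> //; first by rewrite imsetU fsigma fL.
move=> tau ts; rewrite !in_nbhd1 // ts.
have injt : {in tau &, injective f}.
  by move=> x y /(subsetP ts) xs /(subsetP ts) ys; apply: injf.
have -> : f @: tau \subset sigma :|: link F2 sigma.
  by rewrite -fL -{1}fsigma -imsetU imsetS.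
have fD : f @: tau :\: sigma = f @: (tau :\: sigma).
  apply/setP => y; rewrite inE; apply/andP/imsetP => [[yS /imsetP[x xt e]]|[x]].
    exists x => //; rewrite inE xt andbT; apply: contraNN yS => xS.
    by rewrite e finS // (subsetP ts).
  rewrite inE => /andP[xS xt ->]; rewrite imset_f // finS //.
  exact: (subsetP ts).
have -> : #|f @: tau :\: sigma| = #|tau :\: sigma|.
  rewrite fD card_in_imset // => x y; rewrite !inE => /andP[_ xt] /andP[_ yt].
  exact: injt.
rewrite !in_complex_of card_in_imset //.
case: (leqP #|tau| k.+1) => //= ct; case: (leqP #|tau :\: sigma| 2); rewrite ?andbF //.
move=> ctD; rewrite !andbT.
have [ct2|ct2] := eqVneq #|tau| k.+2; last first.
  by apply/idP/idP => [/(subsetP sF1)|/(subsetP sF2)]; rewrite inE ?(card_in_imset injt) (negPf ct2).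
have cID := cardsID sigma tau.
have cIs : #|tau :&: sigma| <= k.+1 by rewrite -cs subset_leq_card // subsetIr.
have inL x : x \in tau -> x \notin sigma -> x \in link F1 sigma.
  by move=> xt xS; move/subsetP: ts => /(_ _ xt); rewrite inE (negPf xS).
have tE : tau = (tau :\: sigma) :|: (tau :&: sigma).
  by apply/setP => x; rewrite !inE; case: (x \in sigma); case: (x \in tau).
have fI : f @: (tau :&: sigma) = tau :&: sigma.
  rewrite -[RHS]imset_id; apply: eq_in_imset => x; rewrite inE => /andP[_].
  exact: fs.
(* As [tau] has one vertex more than [sigma], [tau :\: sigma] is nonempty. *)
have [/eqP/cards1P[v tv]|/eqP c2] : #|tau :\: sigma| = 1 \/ #|tau :\: sigma| = 2 by lia.
  have Is : tau :&: sigma = sigma.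
    apply/eqP; by rewrite eqEcard subsetIr cs /= -ltnS -ct2 -cID tv cards1 addn1 ltnSn.
  have vL : v \in link F1 sigma.
    by move/setP: tv => /(_ v); rewrite !inE eqxx => /andP[vS vt]; have := inL v vt vS; rewrite inE.
  rewrite tE imsetU tv fI Is imset_set1.
  by move: (fL2 _ vL) (vL); rewrite !inE => -> ->.
case/cards2P: c2 => v [w [vw tvw]].
have cI : #|tau :&: sigma| = k by move: cID; rewrite tvw cards2 vw; lia.
have /eqP/cards1P[a sa] : #|sigma :\: tau| = 1.
  by have := cardsID tau sigma; rewrite setIC; lia.
have vwL x : x \in [set v; w] -> x \in link F1 sigma.
  by rewrite -tvw inE => /andP[xS xt]; apply: inL.
rewrite tE imsetU tvw fI imsetU !imset_set1 -!setUA.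
apply: (fF _ a) => //.
- by apply/setP => x; move/setP: sa => /(_ x); rewrite !inE => <-; case: (x \in tau); rewrite ?orbF.
- by move/setP: sa => /(_ a); rewrite !inE eqxx => /andP[/negPf ->].
- by apply: vwL; rewrite set21.
- by apply: vwL; rewrite set22.
Qed.
End Neighbourhoods.

(** * Counting by fibres and by isomorphism classes *)

Lemma leq_card_fibres (T U : finType) (B : {set T}) (C : {set U}) (h : T -> U)
    (m : nat) :
  {in B, forall x, h x \in C} ->
  (forall x, x \in B -> #|[set y in B | h y == h x]| <= m) ->
  #|B| <= m * #|C|.
Proof.
move=> hC hm; rewrite -sum1_card (partition_big h (mem C)) //=.
rewrite mulnC -sum_nat_const; apply: leq_sum => c cC; rewrite sum1dep_card.
have [->|[x]] := set_0Vmem [set y in B | h y == c]; first by rewrite cards0.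
by rewrite inE => /andP[xB /eqP <-]; apply: hm.
Qed.

Lemma leq_expl (m n e : nat) : m <= n -> m ^ e <= n ^ e.
Proof. by case: e => // e mn; rewrite leq_exp2r. Qed.

(** The isomorphism [f] determines [F], whose members are the faces that [f] sends into the complex
    of [F0]; so there are no more [F] than vertex maps. *)
Lemma card_iso_fibre n d (B : {set {set {set 'I_n}}}) (F0 : {set {set 'I_n}}) :
  (forall F, F \in B -> F \subset faces n d /\
     complex_isomorphic (complex_of d F) (complex_of d F0)) ->
  #|B| <= n ^ n.
Proof.
move=> HB; rewrite -[X in X ^ _]card_ord -[X in _ ^ X]card_ord -card_ffun.
pose g (f : {ffun 'I_n -> 'I_n}) :=
  [set tau in faces n d | f @: tau \in complex_of d F0].
apply: leq_trans (leq_imset_card g _); apply: subset_leq_card.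
apply/subsetP => F /HB[sF [f [_ _ fF]]]; apply/imsetP; exists (finfun f) => //.
apply/setP => tau; rewrite -[in LHS](complex_of_faces sF) in_setI fF ?finset.subsetT //.
rewrite [in RHS]in_set andbC; congr (_ && _).
by congr (_ \in complex_of d F0); apply: eq_imset => x; rewrite ffunE.
Qed.

(** * Codes that determine the neighbourhoods *)

Section Codes.
Variables n k : nat.
Implicit Types (F : {set {set 'I_n}}) (sigma tau : {set 'I_n}).

Definition sets_of_card (j : nat) := {s : {set 'I_n} | #|s| == j}.

Lemma card_sets_of_card j : #|{: sets_of_card j}| = 'C(n, j).
Proof. by rewrite card_sig -[X in 'C(X, _)]card_ord -card_draws cardsE. Qed.

(* A configuration [(pi, a, v, w)] is a triple of top simplices
   [a v pi], [a w pi], [v w pi] in a common set of [k.+3] vertices. *)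
Definition triples F : {set sets_of_card k * 'I_n * 'I_n * 'I_n} :=
  [set q : sets_of_card k * 'I_n * 'I_n * 'I_n | let: (pi, a, v, w) := q in
    [&& a \notin val pi, v != w, v \in link F (a |: val pi),
        w \in link F (a |: val pi) & v |: (w |: val pi) \in F]].

(** Ranks allow links of two complexes to be compared without recording the links themselves, which
    would amount to recording [F]. *)
Definition link_rank F sigma (v : 'I_n) : 'I_n.+1 :=
  inord (index v (enum (link F sigma))).

Definition link_degrees F : {ffun sets_of_card k.+1 -> 'I_n.+1} :=
  [ffun sigma => inord #|link F (val sigma)|].

Definition ranked_triples F :
    {set sets_of_card k * 'I_n * 'I_n.+1 * 'I_n.+1} :=
  [set (let: (pi, a, v, w) := q in
        (pi, a, link_rank F (a |: val pi) v, link_rank F (a |: val pi) w))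
    | q in triples F].

Lemma card_ranked_triples F : #|ranked_triples F| <= #|triples F|.
Proof. exact: leq_imset_card. Qed.

Lemma link_rankE F sigma v : v \in link F sigma ->
  link_rank F sigma v = index v (enum (link F sigma)) :> nat.
Proof.
move=> vL; rewrite inordK // ltnS.
apply: leq_trans (_ : #|link F sigma| <= _); last by rewrite -[leqRHS]card_ord max_card.
by rewrite cardE ltnW // index_mem mem_enum.
Qed.

(** The passage to ranks merges no two configurations: [pi] and [a] are kept, hence the link is the
    same, and ranks are injective on it. *)
Lemma ranked_triplesP F (pi : sets_of_card k) a v w :
  a \notin val pi -> v != w ->
  v \in link F (a |: val pi) -> w \in link F (a |: val pi) ->
  (v |: (w |: val pi) \in F) =
  ((pi, a, link_rank F (a |: val pi) v, link_rank F (a |: val pi) w)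
     \in ranked_triples F).
Proof.
move=> ap vw vL wL; apply/idP/imsetP => [vwF|].
  by exists (pi, a, v, w) => //; rewrite in_set ap vw vL wL.
have rank_inj x y : x \in link F (a |: val pi) -> y \in link F (a |: val pi) ->
    link_rank F (a |: val pi) x = link_rank F (a |: val pi) y -> x = y.
  move=> xL yL /(congr1 val) /=; rewrite !link_rankE //.
  by move=> e; apply: (index_inj x) e; rewrite mem_enum.
case=> -[[[pi' a'] v'] w']; rewrite in_set => /and5P[_ _ v'L w'L vwF] [e1 e2].
subst pi' a' => /(rank_inj _ _ vL v'L) -> /(rank_inj _ _ wL w'L) ->.
exact: vwF.
Qed.

Lemma nbhd1_isomorphic_of_codes F1 F2 sigma :
  F1 \subset faces n k.+1 -> F2 \subset faces n k.+1 -> #|sigma| = k.+1 ->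
  link_degrees F1 = link_degrees F2 -> ranked_triples F1 = ranked_triples F2 ->
  nbhd1_isomorphic k.+1 (complex_of k.+1 F1) (complex_of k.+1 F2) sigma.
Proof.
move=> sF1 sF2 cs ed et.
have cL : #|link F1 sigma| = #|link F2 sigma|.
  have cs' : #|sigma| == k.+1 by rewrite cs.
  move/ffunP: ed => /(_ (exist _ sigma cs')); rewrite !ffunE => /(congr1 val) /=.
  by rewrite !inordK // ltnS -[leqRHS]card_ord max_card.
(* A vertex of the first link goes to the vertex of equal rank in the second; by [lt_rank] the
   default of [nth] is never reached. *)
pose f x := if x \in link F1 sigma
  then nth x (enum (link F2 sigma)) (index x (enum (link F1 sigma))) else x.
have lt_rank x : x \in link F1 sigma ->
    index x (enum (link F1 sigma)) < size (enum (link F2 sigma)).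
  by move=> xL; rewrite -cardE -cL cardE index_mem mem_enum.
have fL x : x \in link F1 sigma -> f x \in link F2 sigma.
  by move=> xL; rewrite /f xL -mem_enum mem_nth // lt_rank.
have frank x : x \in link F1 sigma ->
    link_rank F2 sigma (f x) = link_rank F1 sigma x.
  move=> xL; apply: val_inj => /=; rewrite !link_rankE ?fL // /f xL.
  by rewrite index_uniq ?enum_uniq // lt_rank.
have finj : {in link F1 sigma &, injective f}.
  move=> x y xL yL e; have := frank x xL; rewrite e frank // => /(congr1 val).
  rewrite /= !link_rankE // => /esym e'.
  by apply: (index_inj x) e'; rewrite mem_enum.
apply: (@nbhd1_isomorphic_of_bij _ _ _ _ _ f) => //.
- move=> x xs; rewrite /f ifF //; apply: contraTF xs.
  exact: link_notin sF1 cs.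
- apply/eqP; rewrite eqEcard card_in_imset // cL leqnn andbT.
  by apply/subsetP => _ /imsetP[x xL ->]; apply: fL.
move=> pi a v w es ap vL wL vw.
have cpi : #|pi| == k by move: cs; rewrite es cardsU1 ap add1n => -[->].
rewrite es in vL wL frank fL finj *.
rewrite (ranked_triplesP (pi := exist _ pi cpi) ap vw vL wL).
rewrite (ranked_triplesP (pi := exist _ pi cpi) ap _ (fL _ vL) (fL _ wL)).
  by rewrite et !frank.
by apply: contra_neq vw; apply: finj.
Qed.

(** Complexes of [B] with equal codes are isomorphic, so each fibre has at most [n ^ n] elements.
    The other two terms of the exponent bound the number of degree functions and of sets of ranked
    triples. *)
Lemma card_reconstructible (B : {set {set {set 'I_n}}}) (t : nat) :
  0 < n ->
  (forall F, F \in B -> F \subset faces n k.+1 /\ #|triples F| <= t) ->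
  (forall F1 F2, F1 \in B -> F2 \in B ->
    (forall sigma, sigma \in faces n k ->
      nbhd1_isomorphic k.+1 (complex_of k.+1 F1) (complex_of k.+1 F2) sigma) ->
    complex_isomorphic (complex_of k.+1 F1) (complex_of k.+1 F2)) ->
  #|B| <= n.+1 ^ (n + n ^ k.+1 + (k + 4) * t).
Proof.
move=> n_gt0 Bt Biso.
pose C := finset.setX [set: {ffun sets_of_card k.+1 -> 'I_n.+1}]
  [set A : {set sets_of_card k * 'I_n * 'I_n.+1 * 'I_n.+1} | #|A| <= t].
apply: leq_trans (_ : n ^ n * #|C| <= _).
  apply: (@leq_card_fibres _ _ _ _ (fun F => (link_degrees F, ranked_triples F))).
    move=> F /Bt[_ Ft]; rewrite !inE /=.
    exact: leq_trans (card_ranked_triples F) Ft.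
  move=> F0 F0B; apply: (@card_iso_fibre _ k.+1 _ F0) => F.
  rewrite inE => /andP[FB /eqP[ed et]]; have [sF _] := Bt _ FB.
  split=> //; apply: Biso => // sigma; rewrite inE => /eqP cs.
  by apply: nbhd1_isomorphic_of_codes => //; have [] := Bt _ F0B.
rewrite cardsX cardsT card_ffun card_ord card_sets_of_card !expnD -mulnA.
apply: leq_mul; first exact: leq_expl.
apply: leq_mul; first by rewrite leq_pexp2l // bin_leq_exp.
apply: leq_trans (card_few_subsets _ _) _.
rewrite expnM !card_prod card_sets_of_card !card_ord.
(* Of the factors [n.+1], [k] account for [pi], one for [a], two for the ranks, and the last absorbs
   the successor in [card_few_subsets]. *)
apply: leq_expl; have -> : k + 4 = (k + 1 + 2).+1 by lia.
rewrite expnS.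
apply: leq_trans (_ : (n.+1 ^ (k + 1 + 2)).+1 <= _).
  rewrite ltnS expnD (expnD _ k) -mulnA; apply: leq_mul; last by rewrite mulnn.
  by apply: leq_mul => //; apply: leq_trans (bin_leq_exp _ _) (leq_expl _ _).
have := expn_gt0 n.+1 (k + 1 + 2); rewrite /=; nia.
Qed.
End Codes.

(** * Probability estimates *)

Local Open Scope ring_scope.

(** This is the probability that all of [A] is chosen. In the expansion of the product of
    [f x + g x] over sets [F], the zeros of [f] off [G] and of [g] on [A] leave only the [F] between
    [A] and [G]. *)
Lemma sum_powerset_superset (R : comPzRingType) (T : finType) (G A : {set T}) (p : R) :
  A \subset G ->
  \sum_(F in powerset G | A \subset F)
    \prod_(x in G) (if x \in F then p else 1 - p) = p ^+ #|A|.
Proof.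
move=> sAG.
pose f x := if x \in G then p else 0.
pose g x := if x \in A then 0 else if x \in G then 1 - p else 1.
transitivity (\prod_x (f x + g x)); last first.
  rewrite -prodr_const [RHS]big_mkcond /=; apply: eq_bigr => x _; rewrite /f /g.
  case: (boolP (x \in A)) => [xA|_]; first by rewrite (subsetP sAG) // addr0.
  by case: ifP => _; [rewrite addrC subrK | rewrite add0r].
rewrite bigA_distr [LHS]big_mkcond /=; apply: eq_bigr => F _.
rewrite powersetE; case: ifPn => [/andP[FG AF]|].
  rewrite [LHS]big_mkcond /=; apply: eq_bigr => x _; rewrite /f /g.
  case: (boolP (x \in F)) => [xF|xF]; first by rewrite (subsetP FG).
  suff /negPf -> : x \notin A by [].
  by apply: contraNN xF; apply: (subsetP AF).
rewrite negb_and => /orP[] /subsetPn[x]; [move=> xF xG | move=> xA xF].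
  by rewrite (bigD1 x) //= xF /f (negPf xG) mul0r.
by rewrite (bigD1 x) //= (negPf xF) /g xA mul0r.
Qed.

Section Probability.
Variables (R : realType) (n k : nat) (p : R).
Hypothesis p_ge0 : 0 <= p.

Let weight (F : {set {set 'I_n}}) : R :=
  \prod_(tau in faces n k.+1) (if tau \in F then p else 1 - p).

Lemma weight_ge0 F : p <= 1 -> 0 <= weight F.
Proof. by move=> p1; apply: prodr_ge0 => tau _; case: ifP => // _; rewrite subr_ge0. Qed.

Lemma LM_prob_ge0 (E : {set {set 'I_n}} -> Prop) : p <= 1 ->
  0 <= LM_prob k.+1 p E.
Proof. by move=> p1; apply: sumr_ge0 => F _; apply: weight_ge0. Qed.

(** When [p <= 1 - p], the empty set of top simplices is the most likely one. *)
Lemma weight_le F : p <= 1 / 2 -> weight F <= (1 - p) ^+ 'C(n, k.+2).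
Proof.
have p0 := p_ge0; move=> p12; have <- : #|faces n k.+1| = 'C(n, k.+2).
  by rewrite /faces card_draws card_ord.
rewrite -prodr_const; apply: ler_prod => tau _.
by case: ifP => _; apply/andP; split; lra.
Qed.

(** By linearity of expectation: there are at most [n ^ k.+3] quadruples, and each one that can
    occur requires three distinct top simplices, all present with probability [p ^+ 3]. *)
Lemma expect_triples : p <= 1 ->
  \sum_(F in powerset (faces n k.+1)) weight F * #|triples k F|%:R
  <= n%:R ^+ k.+3 * p ^+ 3.
Proof.
move=> p1; pose T := (sets_of_card n k * 'I_n * 'I_n * 'I_n)%type.
apply: (@le_trans _ _ (\sum_(q : T) p ^+ 3)); last first.
  rewrite sumr_const -[leLHS]mulr_natl -natrX ler_wpM2r ?exprn_ge0 // ler_nat.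
  rewrite !card_prod card_sets_of_card !card_ord -!mulnA.
  by rewrite -[k.+3]addn3 expnD leq_mul ?bin_leq_exp.
under eq_bigr => F _ do rewrite -sum1_card natr_sum mulr_sumr big_mkcond /=.
rewrite exchange_big /=; apply: ler_sum => -[[[pi a] v] w] _.
pose A := [set v |: (a |: val pi); w |: (a |: val pi); v |: (w |: val pi)].
have tA F : (pi, a, v, w) \in triples k F -> A \subset F.
  rewrite in_set => /and5P[_ _ vL wL vwF]; rewrite !finset.subUset !finset.sub1set.
  by move: vL wL; rewrite !inE => -> ->.
(* A quadruple that occurs for no [F] contributes 0. Otherwise a witness [F0] shows that the three
   simplices are distinct and of the right size. *)
have [F0 /andP[sF0 tF0]|none] := pickP [pred F : {set {set 'I_n}} |
    (F \subset faces n k.+1) && ((pi, a, v, w) \in triples k F)]; last first.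
  rewrite big1 ?exprn_ge0 // => F; rewrite powersetE => sF.
  by have := none F; rewrite /= sF /= => ->.
have cA : #|A| = 3%N.
  have := tF0; rewrite in_set => /and5P[ap vw vL wL vwF].
  have cap : #|a |: val pi| = k.+1 by rewrite cardsU1 ap (eqP (valP pi)).
  have vn := link_notin sF0 cap vL; have wn := link_notin sF0 cap wL.
  (* Only the first of these two simplices contains [v]; the third simplex of [A] lacks [a]. *)
  have e1 : v |: (a |: val pi) != w |: (a |: val pi).
    by apply: contraNneq vn => /setP/(_ v); rewrite !inE eqxx (negPf vw) /= => <-.
  have e2 x : x |: (a |: val pi) != v |: (w |: val pi).
    apply/eqP => /setP/(_ a); rewrite !inE eqxx orbT (negPf ap) orbF.
    by move: vn wn; rewrite !inE !negb_or => /andP[]; rewrite eq_sym => /negPf -> _ /andP[]; rewrite eq_sym => /negPf ->.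
  rewrite /A finset.setUC cardsU1 cards2 e1 !inE negb_or.
  by rewrite !(eq_sym (v |: (w |: val pi))) !e2.
have sA : A \subset faces n k.+1 by apply: subset_trans sF0; apply: tA.
rewrite -cA -(sum_powerset_superset p sA) [leRHS]big_mkcondr /=.
apply: ler_sum => F _; case: ifP => [/tA ->|_]; first by rewrite mulr1.
by case: ifP => // _; apply: weight_ge0.
Qed.

(** On [E] the neighbourhoods determine the complex up to isomorphism. Markov's inequality handles
    more than [t] configurations; the rest is a number of complexes times the largest weight. *)
Lemma LM_prob_reconstructible (E : {set {set 'I_n}} -> Prop) (t : nat) :
  (0 < n)%N -> p <= 1 / 2 ->
  (forall F1 F2 : {set {set 'I_n}}, F1 \subset faces n k.+1 -> F2 \subset faces n k.+1 ->
    E (complex_of k.+1 F1) -> E (complex_of k.+1 F2) ->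
    (forall sigma, sigma \in faces n k ->
      nbhd1_isomorphic k.+1 (complex_of k.+1 F1) (complex_of k.+1 F2) sigma) ->
    complex_isomorphic (complex_of k.+1 F1) (complex_of k.+1 F2)) ->
  LM_prob k.+1 p E <= n%:R ^+ k.+3 * p ^+ 3 / t.+1%:R +
    n.+1%:R ^+ (n + n ^ k.+1 + (k + 4) * t) * (1 - p) ^+ 'C(n, k.+2).
Proof.
move=> n0 p12 Eiso; have p1 : p <= 1 by lra.
rewrite /LM_prob (bigID (fun F => t < #|triples k F|)%N) /=; apply: lerD.
  rewrite ler_pdivlMr ?ltr0n // mulr_suml; apply: le_trans (expect_triples p1).
  rewrite [leRHS](bigID (fun F => `[< E (complex_of k.+1 F) >] && (t < #|triples k F|)%N)) /=.
  under [X in _ <= X + _]eq_bigl => F do rewrite andbA.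
  rewrite -[leLHS]addr0; apply: lerD.
    apply: ler_sum => F /andP[_ tF]; apply: ler_wpM2l; first exact: weight_ge0.
    by rewrite ler_nat.
  by apply: sumr_ge0 => F _; rewrite mulr_ge0 // weight_ge0.
pose B := [set F in powerset (faces n k.+1) |
  `[< E (complex_of k.+1 F) >] && (#|triples k F| <= t)%N].
apply: (@le_trans _ _ (\sum_(F in B) (1 - p) ^+ 'C(n, k.+2))).
  rewrite (eq_bigl (mem B)); last by move=> F; rewrite !inE -leqNgt andbA.
  by apply: ler_sum => F _; apply: weight_le.
rewrite sumr_const -[leLHS]mulr_natl ler_wpM2r ?exprn_ge0 ?subr_ge0 // -natrX ler_nat.
apply: card_reconstructible => // [F|F1 F2].
  by rewrite !inE => /and3P[].
rewrite !inE => /and3P[s1 /asboolP e1 _] /and3P[s2 /asboolP e2 _].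
exact: Eiso.
Qed.
End Probability.

(** * Asymptotic estimates *)

Lemma exp_leq_bin (n k : nat) : (k.*2 <= n)%N ->
  (n ^ k <= 2 ^ k * k`! * 'C(n, k))%N.
Proof.
move=> kn; rewrite -mulnA [(k`! * _)%N]mulnC bin_ffact ffact_prod.
have expE m : (m ^ k = \prod_(i < k) m)%N by rewrite prod_nat_const card_ord.
rewrite !expE -big_split /=.
(* Each factor [n - i] of the falling factorial is at least [n / 2], because [i < k <= n / 2]. *)
by apply: leq_prod => i _; have := ltn_ord i; lia.
Qed.

Section Asymptotics.
Variable R : realType.
Implicit Types (r C alpha eps : R).

Lemma near_le_powR r C : 0 < r -> \forall n \near \oo%classic, C <= n%:R `^ r.
Proof.
move=> r0; near=> n; apply: (@le_trans _ _ `|C|); first exact: ler_norm.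
have -> : `|C| = (`|C| `^ r^-1) `^ r.
  by rewrite -powRrM mulVf ?gt_eqF // powRr1.
apply: ge0_ler_powR; rewrite ?nnegrE ?powR_ge0 ?(ltW r0) //.
near: n; exact: nbhs_infty_ger.
Unshelve. all: by end_near. Qed.

(** The logarithm of the first factor is of order at most [n^(D - del) ln n], whereas the second is
    at most [exp(- c n^D)]; the power [n^del] beats the logarithm. *)
Lemma near_tail_le (k : nat) alpha eps : alpha < 1 -> 0 < eps -> eps < 1 ->
  1 - 2 * alpha + 2 * eps <= 0 ->
  \forall n \near \oo%classic,
    n.+1%:R ^+ (n + n ^ k.+1 +
      (k + 4) * Num.trunc (n%:R `^ (k.+3%:R - 3 * alpha + eps) : R)) *
    (1 - n%:R `^ (- alpha)) ^+ 'C(n, k.+2) <= n%:R `^ (- eps) :> R.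
Proof.
move=> a1 e0 e1 ae.
(* With [D] as below, [D - (k + 1) = 1 - alpha] and [D - (k + 3 - 3 alpha + eps) = 2 alpha - 1 - eps
   >= eps]. Hence [n ^ k.+1] and the truncated power are both at most [n^(D - del)]. *)
pose del := Num.min eps (1 - alpha).
have d0 : 0 < del by rewrite lt_min e0 subr_gt0.
have de : del <= eps by rewrite ge_min lexx.
have da : del <= 1 - alpha by rewrite ge_min lexx orbT.
pose D : R := k.+2%:R - alpha.
pose c : R := (2 ^ k.+2 * (k.+2)`!)%:R^-1.
have b0 : (0 < 2 ^ k.+2 * (k.+2)`!)%N by rewrite muln_gt0 expn_gt0 fact_gt0.
have c0 : 0 < c by rewrite invr_gt0 ltr0n.
(* The factor [4 / del] comes from [hln], and [k + 6] is [1 + 1 + (k + 4)], the sum of the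
   coefficients in the exponent. *)
pose K : R := 4 / del * (k + 6)%:R.
near=> n.
have n2 : (2 <= n)%N by near: n; exact: nbhs_infty_ge.
have kn : ((k.+2).*2 <= n)%N by near: n; exact: nbhs_infty_ge.
have hK : (K + 1) / c <= n%:R `^ (del / 2).
  by near: n; apply: near_le_powR; rewrite divr_gt0.
set x : R := n%:R in hK *.
have x1 : 1 <= x by rewrite ler1n ltnW.
have x0 : 0 < x by lra.
have p1 : x `^ (- alpha) <= 1.
  by rewrite -(powRr0 x) ler_powR //; lra.
set t := Num.trunc _; set m := (n + _ + _)%N.
have hm : m%:R <= (k + 6)%:R * x `^ (D - del).
  have h1 : x `^ 1 <= x `^ (D - del).
    by rewrite ler_powR // /D -natr1 -natr1; have := ler0n R k; lra.
  have h2 : x ^+ k.+1 <= x `^ (D - del).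
    by rewrite -powR_mulrn ?(ltW x0) // ler_powR // /D -[k.+2%:R]natr1; lra.
  have h3 : t%:R <= x `^ (D - del).
    apply: (@le_trans _ _ (x `^ (k.+3%:R - 3 * alpha + eps))).
      by rewrite truncn_le powR_ge0.
    by rewrite ler_powR // /D -[k.+3%:R]natr1; lra.
  rewrite /m !natrD natrM natrX natrD -/x.
  rewrite powRr1 ?(ltW x0) // in h1.
  have : (k%:R + 4) * t%:R <= (k%:R + 4) * x `^ (D - del).
    by rewrite ler_wpM2l // -natrD.
  lra.
(* Half of [del] pays for the logarithm: [ln y < y] at [y = x^(del / 2)], after [n + 1 <= n^2]. *)
have hln : ln n.+1%:R <= 4 / del * x `^ (del / 2).
  have h1 : n.+1%:R <= x `^ 2.
    rewrite (powR_mulrn 2) ?(ltW x0) // -natrX ler_nat expnS expn1.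
    apply: leq_trans (leq_mul (leqnn n) n2).
    by rewrite muln2 -addnn -addn1 leq_add2l ltnW.
  have h2 : ln (n.+1%:R : R) <= 2 * ln x.
    by rewrite -ln_powR ler_ln ?posrE ?ltr0n ?powR_gt0.
  have h3 : del / 2 * ln x <= x `^ (del / 2).
    by rewrite -ln_powR ltW // ln_sublinear // powR_gt0.
  apply: (le_trans h2).
  rewrite (_ : 2 * ln x = 4 / del * (del / 2 * ln x)); last by field; rewrite gt_eqF.
  by rewrite ler_wpM2l // ltW // divr_gt0.
have hN : c * x ^+ k.+2 <= 'C(n, k.+2)%:R.
  rewrite /c mulrC ler_pdivrMr ?ltr0n //.
  by rewrite -natrX -natrM ler_nat mulnC exp_leq_bin.
have hpN : c * x `^ D <= x `^ (- alpha) * 'C(n, k.+2)%:R.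
  have -> : c * x `^ D = x `^ (- alpha) * (c * x ^+ k.+2).
    rewrite -powR_mulrn ?(ltW x0) // mulrCA -powRD; last by rewrite (gt_eqF x0) implybT.
    by rewrite addrC.
  by apply: ler_wpM2l hN; apply: powR_ge0.
have hlm : ln n.+1%:R * m%:R <= K * x `^ (D - del / 2).
  apply: (@le_trans _ _ (4 / del * x `^ (del / 2) * ((k + 6)%:R * x `^ (D - del)))).
    by apply: ler_pM => //; rewrite ln_ge0 // ler1n.
  rewrite (_ : D - del / 2 = del / 2 + (D - del)); last by lra.
  rewrite [in leRHS]powRD; last by rewrite (gt_eqF x0) implybT.
  by rewrite [leLHS]mulrACA.
apply: (@le_trans _ _ (expR (ln n.+1%:R * m%:R) *
                       expR (- x `^ (- alpha) * 'C(n, k.+2)%:R))).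
  apply: ler_pM; rewrite ?exprn_ge0 ?subr_ge0 ?ler0n //.
    by rewrite expRM_natr lnK // posrE ltr0n.
  rewrite expRM_natr lerXn2r ?nnegrE ?subr_ge0 ?expR_ge0 //.
  exact: expR_ge1Dx.
rewrite -expRD.
(* The [+ 1] in [hK] leaves a surplus [x^(D - del / 2)], which is at least [x]. *)
apply: (@le_trans _ _ (expR (- x))).
  rewrite ler_expR mulNr.
  have hD : x `^ D = x `^ (D - del / 2) * x `^ (del / 2).
    by rewrite -powRD ?subrK // (gt_eqF x0) implybT.
  have hx : x <= x `^ (D - del / 2).
    rewrite -[leLHS]powRr1 ?(ltW x0) // ler_powR // /D -natr1 -natr1.
    by have := ler0n R k; lra.
  rewrite ler_pdivrMr // in hK.
  have : (K + 1) * x `^ (D - del / 2) <= c * x `^ D.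
    rewrite hD [leRHS]mulrC -mulrA [leLHS]mulrC.
    by apply: ler_wpM2l hK; apply: powR_ge0.
  by lra.
rewrite expRN powRN lef_pV2 ?posrE ?expR_gt0 ?powR_gt0 //.
apply: (@le_trans _ _ x); last by have := expR_ge1Dx x; lra.
by rewrite -[leRHS]powRr1 ?(ltW x0) // ler_powR // ltW.
Unshelve. all: by end_near. Qed.
End Asymptotics.

(** * Choice of the exponents and final estimate *)

Theorem theorem3p2 (R : realType) (d : nat) (hd : (1 <= d)%N)
    (alpha : R) (halpha1 : 1 / 2 < alpha) (halpha2 : alpha < 1) :
  with_high_probability
    (fun (n : nat) (E : {set {set 'I_n}} -> Prop) =>
       LM_prob d (n%:R `^ (- alpha)) E)
    (fun (n : nat) (Y : {set {set 'I_n}}) =>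
       exists Xt : {set {set 'I_n}},
         [/\ full_skeleton_complex d Xt,
             (forall sigma : {set 'I_n}, sigma \in faces n d.-1 ->
                nbhd1_isomorphic d Xt Y sigma)
           & ~ complex_isomorphic Xt Y]).
Proof.
case: d hd => // k _.
(* This gives [1 - 2 alpha + 2 eps = 0], the limit case allowed by [near_tail_le]. *)
pose eps := alpha - 1 / 2.
have e0 : 0 < eps by rewrite subr_gt0.
exists (eps / 2); first by rewrite divr_gt0.
apply/eqoP => e e_gt0.
near=> n.
have n1 : (1 <= n)%N by near: n; exact: nbhs_infty_ge.
have hp : 2 <= n%:R `^ alpha by near: n; apply: near_le_powR; lra.
have he : 2 / e <= n%:R `^ (eps / 2).
  by near: n; apply: near_le_powR; rewrite divr_gt0.
have htail : n.+1%:R ^+ (n + n ^ k.+1 +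
      (k + 4) * Num.trunc (n%:R `^ (k.+3%:R - 3 * alpha + eps) : R)) *
    (1 - n%:R `^ (- alpha)) ^+ 'C(n, k.+2) <= n%:R `^ (- eps) :> R.
  by near: n; apply: near_tail_le; rewrite /eps; lra.
set x : R := n%:R in hp he htail *.
have x0 : 0 < x by rewrite ltr0n.
have p0 : 0 <= x `^ (- alpha) by apply: powR_ge0.
have p12 : x `^ (- alpha) <= 1 / 2.
  by rewrite powRN div1r lef_pV2 ?posrE ?powR_gt0.
have p1 : x `^ (- alpha) <= 1.
  by apply: le_trans p12 _; rewrite ler_pdivrMr // mul1r ler1n.
rewrite (ger0_norm (LM_prob_ge0 _ p0 _ p1)) (ger0_norm (powR_ge0 _ _)).
apply: le_trans (@LM_prob_reconstructible R n k _ p0 _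
  (Num.trunc (x `^ (k.+3%:R - 3 * alpha + eps))) n1 p12 _) _.
  (* The event is the failure of the conclusion: were the two complexes not isomorphic, the first
     would serve as [Xt] for the second. *)
  move=> F1 F2 s1 s2 _ E2 iso; apply: contrapT => niso; apply: E2.
  by exists (complex_of k.+1 F1); split=> //; exists F1.
(* The truncation plus one exceeds [x^(k + 3 - 3 alpha + eps)], which leaves [x^(- eps)]. *)
have hmarkov : x ^+ k.+3 * x `^ (- alpha) ^+ 3 /
    (Num.trunc (x `^ (k.+3%:R - 3 * alpha + eps))).+1%:R <= x `^ (- eps).
  rewrite ler_pdivrMr ?ltr0n // -powR_mulrn ?(ltW x0) // -[(_ `^ _) ^+ 3]powR_mulrn //.
  rewrite -powRrM -powRD ?(gt_eqF x0) ?implybT //.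
  rewrite (_ : _ + _ = - eps + (k.+3%:R - 3 * alpha + eps)); last by ring.
  rewrite powRD ?(gt_eqF x0) ?implybT // ler_wpM2l ?powR_ge0 //.
  by rewrite ltW // truncnS_gt.
apply: le_trans (lerD hmarkov htail) _.
have -> : - eps = - (eps / 2) + - (eps / 2) by rewrite -opprD -splitr.
rewrite powRD ?(gt_eqF x0) ?implybT //.
rewrite -mulr2n -[leLHS]mulr_natl mulrA ler_wpM2r ?powR_ge0 //.
rewrite powRN ler_pdivrMr ?powR_gt0 //.
by move: he; rewrite ler_pdivrMr // mulrC.
Unshelve. all: by end_near. Qed.
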